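(* Let $\mathcal G$ be a concave game with a unique interior variationally stable state $x^\star$ that is $\eta$-relatively strongly VS with respect to $h(x)=\sum_{p\in\mathcal N}\vartheta^p(x^p)$, for some $\eta>0$. Let $x=(x^p(t))_{p\in\mathcal N}=C_\epsilon(z(t))$ be generated by the dynamics (MD2$\gamma$) $$\dot z=U(x)-\gamma\alpha(x-\xi),\qquad \dot\xi=\beta(x-\xi),\qquad x=C_\epsilon(z),\qquad \dot\gamma=-\eta\epsilon^{-1}\gamma,$$ where $C_\epsilon=(C^p_\epsilon)_{p\in\mathcal N}$ is induced by $\psi^p_\epsilon=\epsilon\vartheta^p$ and each $\vartheta^p$ is a closed, proper, $\rho$-strongly convex function ($\rho>0$) with $\mathrm{dom}(\vartheta^p)=\Omega^p$. Then for any $\alpha,\beta,\epsilon,\eta>0$, $\gamma_0=\gamma(0)>0$, and any $z(0)\in\mathbb R^n$, $\xi_0=\xi(0)\in\mathbb R^n$, $x_0=C_\epsilon(z(0))$, $x(t)$ converges to $x^\star$ with the rate $$D_h(x^\star,x(t))\le e^{-\eta\epsilon^{-1}t}\Big(\frac{\alpha\gamma_0}{2\beta\epsilon}\|\xi_0-x^\star\|_2^2+D_h(x^\star,x_0)\Big).$$ Furthermore, since $\vartheta^p$ is $\rho$-strongly convex, $$\|x^\star-x(t)\|_2^2\le 2\rho^{-1}e^{-\eta\epsilon^{-1}t}\Big(\frac{\alpha\gamma_0}{2\beta\epsilon}\|\xi_0-x^\star\|_2^2+D_h(x^\star,x_0)\Big).$$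
   Context: **Game.** $\mathcal N=\{1,\dots,N\}$ is the set of players; player $p$ has strategy set $\Omega^p\subseteq\mathbb R^{n_p}$ and payoff $\mathcal U^p:\Omega\to\mathbb R$, where $\Omega=\prod_p\Omega^p\subseteq\mathbb R^n$, $n=\sum_p n_p$; write $x=(x^p;x^{-p})$. The game is a *concave game* if for all $p$: $\Omega^p$ is non-empty, closed and convex; $\mathcal U^p$ is jointly continuous in $x$; and $\mathcal U^p(x^p;x^{-p})$ is concave and continuously differentiable in $x^p$ for all $x^{-p}\in\Omega^{-p}$. It is implicitly assumed that each $\mathcal U^p$ is defined and continuously differentiable on an open set containing $\Omega$. The partial gradient is $U^p(x)=\nabla_{x^p}\mathcal U^p(x^p;x^{-p})$ and the pseudo-gradient is $U=(U^p)_{p\in\mathcal N}$. **Equilibria.** $x^\star\in\Omega$ is a Nash equilibrium (NE) if $\mathcal U^p({x^p}^\star;{x^{-p}}^\star)\ge\mathcal U^p(x^p;{x^{-p}}^\star)$ for all $x^p\in\Omega^p$ and all $p$; it is *interior* if $x^\star\in\mathrm{rint}(\Omega)$. For a differentiable convex function $h:\mathbb R^n\to\mathbb R\cup\{\infty\}$ with $\mathrm{dom}(h)=\Omega$, a NE $x^\star\in\Omega$ is *$\eta$-relatively strongly VS with respect to $h$* if $U(x)^\top(x-x^\star)\le-\eta\,(D_h(x,x^\star)+D_h(x^\star,x))$ for all $x\in\Omega$. **Bregman divergence.** For a proper, closed, convex $f$, $D_f:\mathrm{dom}(f)\times\mathrm{dom}(\partial f)\to\mathbb R$, $D_f(x,y)=f(x)-f(y)-g^\top(x-y)$,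 $g\in\partial f(y)$ (so $g=\nabla f(y)$ where $f$ is differentiable; for differentiation on the boundary of a closed set one uses the subgradient or assumes $f$ is defined and differentiable on an open set containing it). **Mirror map.** For $\epsilon>0$, $C^p_\epsilon(z^p)=\mathrm{argmax}_{y^p\in\Omega^p}\big[{y^p}^\top z^p-\epsilon\vartheta^p(y^p)\big]$. In the dynamics, $z=(z^p)_p$, $\xi=(\xi^p)_p\in\mathbb R^n$ and $\gamma(t)\in\mathbb R$. Strong convexity of $\vartheta^p$ is with respect to the Euclidean norm $\|\cdot\|_2$.
   Formalization: The relative strong VS inequality is required for every subgradient of h at x (not only a gradient extended to the boundary), which excludes sets with relative boundary; with the gradient alone the rate fails, e.g. Ω=[-1,1], θ=x²/2, U=-ηx, z(0)=10. *)

(* Defs.v *)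
From HB Require Import structures.
From mathcomp Require Import all_boot all_order all_algebra.
From mathcomp Require Import all_classical all_reals all_analysis.

Set Implicit Arguments.
Unset Strict Implicit.
Unset Printing Implicit Defensive.

Import Order.TTheory GRing.Theory Num.Theory.
Import numFieldNormedType.Exports.

Local Open Scope classical_set_scope.
Local Open Scope ring_scope.

(* The library norm on ['rV[R]_n] is the sup norm; it only serves for the
   topology. The Euclidean structure is [dot] and [norm2]. *)
Definition dot (R : realType) (n : nat) (u v : 'rV[R]_n) : R :=
  \sum_(i < n) u 0 i * v 0 i.

Definition norm2 (R : realType) (n : nat) (u : 'rV[R]_n) : R :=
  Num.sqrt (dot u u).

Definition gradient (R : realType) (n : nat) (f : 'rV[R]_n -> R^o)
    (x : 'rV[R]_n) : 'rV[R]_n :=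
  \row_(i < n) 'D_(delta_mx 0 i) f x.

Definition affine_hull (R : realType) (n : nat) (A : set 'rV[R]_n) :
    set 'rV[R]_n :=
  [set x | exists k (a : 'I_k -> R) (v : 'I_k -> 'rV[R]_n),
     [/\ forall i, A (v i), \sum_(i < k) a i = 1
       & x = \sum_(i < k) a i *: v i]].

Definition rint (R : realType) (n : nat) (A : set 'rV[R]_n) : set 'rV[R]_n :=
  [set x | A x /\ \forall y \near x, affine_hull A y -> A y].

Definition dom (R : realType) (n : nat) (f : 'rV[R]_n -> \bar R) :
    set 'rV[R]_n :=
  [set x | (f x < +oo)%E].

Definition proper_fun (R : realType) (n : nat) (f : 'rV[R]_n -> \bar R) : Prop :=
  (forall x, (-oo < f x)%E) /\ dom f !=set0.

Definition closed_fun (R : realType) (n : nat) (f : 'rV[R]_n -> \bar R) : Prop :=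
  closed [set z : 'rV[R]_n * R | (f z.1 <= z.2%:E)%E].

(* Strong convexity with respect to the Euclidean norm; ordinary convexity is
   the case [rho = 0]. *)
Definition strongly_convex (R : realType) (n : nat) (rho : R)
    (f : 'rV[R]_n -> \bar R) : Prop :=
  forall (x y : 'rV[R]_n) (t : R), 0 <= t <= 1 ->
    (f (t *: x + (1 - t) *: y)%R
       + (rho / 2 * (t * (1 - t)) * norm2 (x - y) ^+ 2)%:E
     <= t%:E * f x + (1 - t)%:E * f y)%E.

Definition convex_fun (R : realType) (n : nat) (f : 'rV[R]_n -> \bar R) : Prop :=
  strongly_convex 0 f.

Definition subdiff (R : realType) (n : nat) (f : 'rV[R]_n -> \bar R)
    (y : 'rV[R]_n) : set 'rV[R]_n :=
  [set g | dom f y /\ forall x, (f y + (dot g (x - y))%:E <= f x)%E].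

(* Differentiability of an extended-valued function at a point of the relative
   interior of its domain: the increments are those that stay in [dom f], so
   that domains with empty interior are allowed. When [dom f] has an interior
   point, this is Frechet differentiability on the interior. *)
Definition rint_differentiable (R : realType) (n : nat)
    (f : 'rV[R]_n -> \bar R) : Prop :=
  forall x, rint (dom f) x ->
    exists g : 'rV[R]_n, forall e : R, 0 < e -> \forall y \near x, dom f y ->
      `|fine (f y) - fine (f x) - dot g (y - x)| <= e * norm2 (y - x).

(* The value of D_f(x, y) computed with the subgradient [g] of [f] at [y]. As
   D_f is defined from an unspecified g in the subdifferential, statements about
   it quantify over every such [g]; where [f] is differentiable (relatively to
   its domain) the value does not depend on [g]. *)
Definition bregman (R : realType) (n : nat) (f : 'rV[R]_n -> \bar R)
    (g x y : 'rV[R]_n) : R :=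
  fine (f x) - fine (f y) - dot g (x - y).

(* A joint strategy is a row vector of length \sum_p n p; its block of player p
   is [submxrow x p]. The payoffs are total functions, but they are only
   constrained near the joint strategy set, see [concave_game]. *)
Record game (R : realType) (N : nat) (n : 'I_N -> nat) : Type := Game {
  strat : forall p : 'I_N, set 'rV[R]_(n p);
  payoff : 'I_N -> 'rV[R]_(\sum_(p < N) n p) -> R^o
}.
Arguments strat {R N n} g p.
Arguments payoff {R N n} g p.

Definition joint_strat (R : realType) (N : nat) (n : 'I_N -> nat)
    (G : game R n) : set 'rV[R]_(\sum_(p < N) n p) :=
  [set x | forall p, strat G p (submxrow x p)].

(* (y ; x^{-p}) *)
Definition deviate (R : realType) (N : nat) (n : 'I_N -> nat)
    (x : 'rV[R]_(\sum_(p < N) n p)) (p : 'I_N) (y : 'rV[R]_(n p)) :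
    'rV[R]_(\sum_(p < N) n p) :=
  \mxrow_(q < N) dfwith (fun q => submxrow x q) p y q.

Definition continuously_differentiable_on (R : realType) (m : nat)
    (O : set 'rV[R]_m) (f : 'rV[R]_m -> R^o) : Prop :=
  forall x, O x -> differentiable f x /\
    forall v : 'rV[R]_m, {for x, continuous (fun y => 'D_v f y)}.

(* Continuous differentiability on an open neighbourhood of the joint strategy
   set subsumes continuous differentiability in the player's own variable. *)
Definition concave_game (R : realType) (N : nat) (n : 'I_N -> nat)
    (G : game R n) : Prop :=
  forall p : 'I_N,
  [/\ [/\ strat G p !=set0, closed (strat G p)
        & convex_set (strat G p : set (convex_lmodType _))],
      {within joint_strat G, continuous (payoff G p)},
      forall x, joint_strat G x ->
        convex_function (strat G p : set (convex_lmodType _))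
          (fun y => - payoff G p (deviate x y))
    & exists O : set 'rV[R]_(\sum_(p < N) n p),
        [/\ open O, joint_strat G `<=` O
          & continuously_differentiable_on O (payoff G p)]].

Definition pseudo_gradient (R : realType) (N : nat) (n : 'I_N -> nat)
    (G : game R n) (x : 'rV[R]_(\sum_(p < N) n p)) :
    'rV[R]_(\sum_(p < N) n p) :=
  \mxrow_(p < N)
    gradient (fun y : 'rV[R]_(n p) => payoff G p (deviate x y)) (submxrow x p).

Definition nash (R : realType) (N : nat) (n : 'I_N -> nat) (G : game R n)
    (xs : 'rV[R]_(\sum_(p < N) n p)) : Prop :=
  joint_strat G xs /\
  forall (p : 'I_N) (y : 'rV[R]_(n p)), strat G p y ->
    payoff G p (deviate xs y) <= payoff G p xs.

Definition variationally_stable (R : realType) (N : nat) (n : 'I_N -> nat)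
    (G : game R n) (xs : 'rV[R]_(\sum_(p < N) n p)) : Prop :=
  nash G xs /\
  forall x, joint_strat G x -> dot (pseudo_gradient G x) (x - xs) <= 0.

(* The inequality is imposed at the points [x] where D_h(xs, x) is defined,
   i.e. where [h] is subdifferentiable, and for each value of D_h. Imposing it
   for a single subgradient at the relative boundary (such as the restriction of
   the gradient of a smooth extension of [h]) would be too weak for exponential
   convergence: x(t) may then stay at a boundary point while z(t) moves inside
   the normal cone. *)
Definition rel_strongly_VS (R : realType) (N : nat) (n : 'I_N -> nat)
    (G : game R n) (h : 'rV[R]_(\sum_(p < N) n p) -> \bar R) (eta : R)
    (xs : 'rV[R]_(\sum_(p < N) n p)) : Prop :=
  [/\ convex_fun h, dom h = joint_strat G, rint_differentiable h, nash G xs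
    & forall x gs g, joint_strat G x -> subdiff h xs gs -> subdiff h x g ->
        dot (pseudo_gradient G x) (x - xs)
          <= - eta * (bregman h gs x xs + bregman h g xs x)].

Definition separable_sum (R : realType) (N : nat) (n : 'I_N -> nat)
    (theta : forall p : 'I_N, 'rV[R]_(n p) -> \bar R)
    (x : 'rV[R]_(\sum_(p < N) n p)) : \bar R :=
  (\sum_(p < N) theta p (submxrow x p))%E.

(* The set of maximizers over [A] of  y . z - psi y. *)
Definition mirror_argmax (R : realType) (m : nat) (A : set 'rV[R]_m)
    (psi : 'rV[R]_m -> \bar R) (z : 'rV[R]_m) : set 'rV[R]_m :=
  [set y | A y /\ forall y', A y' ->
     ((dot y' z)%:E - psi y' <= (dot y z)%:E - psi y)%E].

(* For strongly convex [theta p] this set is the singleton {C_eps(z)}. *)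
Definition mirror_map (R : realType) (N : nat) (n : 'I_N -> nat)
    (G : game R n) (theta : forall p : 'I_N, 'rV[R]_(n p) -> \bar R) (eps : R)
    (z : 'rV[R]_(\sum_(p < N) n p)) : set 'rV[R]_(\sum_(p < N) n p) :=
  [set x | forall p : 'I_N,
     mirror_argmax (strat G p) (fun y => (eps%:E * theta p y)%E) (submxrow z p)
       (submxrow x p)].

(* Solutions on [0, +oo[: continuous on [0, +oo[, with the differential
   equations holding for t > 0. *)
Definition MD2gamma (R : realType) (N : nat) (n : 'I_N -> nat) (G : game R n)
    (theta : forall p : 'I_N, 'rV[R]_(n p) -> \bar R)
    (alpha beta eps eta : R)
    (z xi x : R -> 'rV[R]_(\sum_(p < N) n p)) (gamma : R -> R^o) : Prop :=
  [/\ [/\ {within `[0, +oo[, continuous z}, {within `[0, +oo[, continuous xi}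
        & {within `[0, +oo[, continuous gamma}],
      forall t : R, 0 < t -> is_derive t 1 z
        (pseudo_gradient G (x t) - (gamma t * alpha) *: (x t - xi t)),
      forall t : R, 0 < t -> is_derive t 1 xi (beta *: (x t - xi t)),
      forall t : R, 0 < t -> is_derive t 1 gamma (- eta * eps^-1 * gamma t)
    & forall t : R, 0 <= t -> mirror_map G theta eps (z t) (x t)].

(* Main.v *)
Require Import Defs.
From mathcomp Require Import all_boot all_order all_algebra.
From mathcomp Require Import all_classical all_reals all_analysis.
From mathcomp Require Import ring lra.
Import Order.TTheory GRing.Theory Num.Theory.
Import numFieldNormedType.Exports.
Set Implicit Arguments.
Unset Strict Implicit.
Local Open Scope classical_set_scope.
Local Open Scope ring_scope.

(** Write [h] for the separable sum of the regularizers and [k] for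
    [eta / eps]. The definition of the mirror map says exactly that
    [z t / eps] is a subgradient of [h] at [x t], so the divergence
    [D t = D_h(xs, x t)] computed with this subgradient satisfies
    [eps * D t = eps * h xs + phi (z t) - dot (z t) xs], where [phi] is the
    conjugate of [eps * h]. Strong convexity of [h] makes [phi] differentiable
    with gradient [x t] at [z t] ([conjugate_gap],
    [is_derive_quadratic_gap]), hence the derivative of [eps * D t] is
    [dot (z' t) (x t - xs)]. For the energy
      [V t = gamma t * alpha / (2 * beta) * |xi t - xs|^2 + eps * D t],
    the correction terms of the dynamics combine into
    [- gamma t * alpha * |x t - xi t|^2 <= 0], and relative strong variational
    stability bounds what remains by [- k * V t]. Therefore [expR (k * t) * V t]
    is nonincreasing, which is the announced rate for the subgradients
    [z t / eps] and [z 0 / eps]; the rate in norm and the convergence follow from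
    [D t >= rho / 2 * |xs - x t|^2].

    There remains to pass to arbitrary subgradients. At a relative boundary
    point of the domain, adding normal vectors to a subgradient changes the value
    of D_h(xs, x), and makes it unbounded since [xs] is a relative interior point
    ([extend_or_normal]). The stability inequality bounds D_h(xs, x) uniformly over
    the subgradients at [x], so this cannot happen: a point at which [h] is
    subdifferentiable is a relative interior point, where differentiability makes
    the divergence independent of the subgradient ([bregman_unique]). *)

(** * The Euclidean inner product *)

Lemma dotC (R : realType) n (u v : 'rV[R]_n) : dot u v = dot v u.
Proof. by apply: eq_bigr => i _; rewrite mulrC. Qed.

Lemma dotDl (R : realType) n (u v w : 'rV[R]_n) :
  dot (u + v) w = dot u w + dot v w.
Proof. by rewrite -big_split; apply: eq_bigr => i _; rewrite mxE mulrDl. Qed.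

Lemma dotZl (R : realType) n (c : R) (u v : 'rV[R]_n) :
  dot (c *: u) v = c * dot u v.
Proof. by rewrite /dot big_distrr; apply: eq_bigr => i _ /=; rewrite mxE mulrA. Qed.

Lemma dotDr (R : realType) n (u v w : 'rV[R]_n) :
  dot u (v + w) = dot u v + dot u w.
Proof. by rewrite dotC dotDl !(dotC _ u). Qed.

Lemma dotZr (R : realType) n (c : R) (u v : 'rV[R]_n) :
  dot u (c *: v) = c * dot u v.
Proof. by rewrite dotC dotZl dotC. Qed.

Lemma dotNl (R : realType) n (u v : 'rV[R]_n) : dot (- u) v = - dot u v.
Proof. by rewrite -scaleN1r dotZl mulN1r. Qed.

Lemma dotNr (R : realType) n (u v : 'rV[R]_n) : dot u (- v) = - dot u v.
Proof. by rewrite dotC dotNl dotC. Qed.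

Definition dotE := (dotDl, dotDr, dotNl, dotNr, dotZl, dotZr).

Lemma dot_ge0 (R : realType) n (u : 'rV[R]_n) : 0 <= dot u u.
Proof. by apply: sumr_ge0 => i _; rewrite -expr2 sqr_ge0. Qed.

Lemma dot_eq0 (R : realType) n (u : 'rV[R]_n) : dot u u = 0 -> u = 0.
Proof.
move=> u0; apply/rowP => i; rewrite mxE.
have /psumr_eq0P/(_ u0 i isT)/eqP : forall j, true -> 0 <= u 0 j * u 0 j.
  by move=> j _; rewrite -expr2 sqr_ge0.
by rewrite mulf_eq0 orbb => /eqP.
Qed.

Lemma sqr_norm2 (R : realType) n (u : 'rV[R]_n) : norm2 u ^+ 2 = dot u u.
Proof. by rewrite sqr_sqrtr// dot_ge0. Qed.

Lemma norm2Z (R : realType) n (c : R) (u : 'rV[R]_n) :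
  norm2 (c *: u) = `|c| * norm2 u.
Proof.
by rewrite /norm2 dotZl dotZr mulrA -expr2 sqrtrM ?sqr_ge0// sqrtr_sqr.
Qed.

Lemma normr_le_norm2 (R : realType) n (u : 'rV[R]_n) : `|u| <= norm2 u.
Proof.
rewrite {1}/Num.Def.normr/= mx_normrE; apply/bigmax_leP.
split=> [|[i j] _]; first exact: sqrtr_ge0.
rewrite (ord1 i)/= -sqrtr_sqr ler_sqrt ?dot_ge0// /dot (bigD1 j)//= -expr2.
by rewrite lerDl sumr_ge0// => l _; rewrite -expr2 sqr_ge0.
Qed.

Lemma dot_blocks (R : realType) N (n : 'I_N -> nat)
    (u v : 'rV[R]_(\sum_(p < N) n p)) :
  dot u v = \sum_(p < N) dot (submxrow u p) (submxrow v p).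
Proof.
have dotM k (a b : 'rV[R]_k) : dot a b = (a *m b^T) 0 0.
  by rewrite mxE; apply: eq_bigr => i _; rewrite mxE.
rewrite dotM -{1}(submxrowK u) -{1}(submxrowK v) tr_mxrow mul_mxrow_mxcol.
by rewrite summxE; apply: eq_bigr => p _; rewrite dotM.
Qed.

Lemma cvg_dot (R : realType) n (T : Type) (F : set_system T) {FF : Filter F}
    (u v : T -> 'rV[R]_n) (a b : 'rV[R]_n) :
  u @ F --> a -> v @ F --> b -> dot (u t) (v t) @[t --> F] --> dot a b.
Proof.
have coord (w : T -> 'rV[R]_n) (c : 'rV[R]_n) i : w @ F --> c ->
    w t 0 i @[t --> F] --> (c 0 i : R^o).
  by move=> wc; exact: (cvg_comp w (fun y : 'rV_n => y 0 i) wc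
                     (@coord_continuous R 1 n 0 i c)).
move=> ua vb; rewrite /dot; apply: (@cvg_big R^o _ +%R) => [|i _].
  exact: add_continuous.
by apply: (@cvgM R); exact: coord.
Qed.

(** The limit [t -> 0+] in an affine upper bound. *)
Lemma le_of_le_affine (R : realType) (a b c : R) :
  (forall t, 0 < t <= 1 -> a <= b + t * c) -> a <= b.
Proof.
move=> abc; rewrite leNgt; apply/negP => ba.
have c0 : 0 < c by have := abc 1; rewrite ltr01 lexx mul1r => /(_ isT); lra.
have [c1|c1] := leP ((a - b) / (2 * c)) 1.
  have := abc ((a - b) / (2 * c)); rewrite c1 divr_gt0 ?subr_gt0//; last by lra.
  have -> : (a - b) / (2 * c) * c = (a - b) / 2 by field; lra.
  move=> /(_ isT); lra.
have := abc 1; rewrite ltr01 lexx mul1r => /(_ isT).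
move: c1; rewrite ltr_pdivlMr; lra.
Qed.

(** * Projections, relative interiors and normal vectors *)

Lemma cvg_homothety (R : realType) (V : normedModType R) (a : R) (b q : V) :
  a *: y + b @[y --> q] --> a *: q + b.
Proof.
by apply: cvgD; [apply: cvgZl_tmp; exact: cvg_id|exact: cvg_cst].
Qed.

(** Convexity of a set, with real coefficients. *)
Definition segment_closed (R : realType) n (A : set 'rV[R]_n) :=
  forall a b t, 0 <= t <= 1 -> A a -> A b -> A (t *: a + (1 - t) *: b).

(** Existence of a projection [q] of [p] on the closure of a convex set, with
    its variational characterization. *)
Lemma closest_point (R : realType) n (A : set 'rV[R]_n) (p : 'rV[R]_n) :
  A !=set0 -> segment_closed A ->
  exists q, closure A q /\ forall k, A k -> dot (p - q) (k - q) <= 0.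
Proof.
move=> [a0 Aa0] Aseg.
pose f y := dot (y - p) (y - p).
have fcont : continuous f.
  have yp (y : 'rV[R]_n) : w - p @[w --> y] --> y - p.
    have := @cvg_homothety R 'rV[R]_n 1 (- p) y.
    by rewrite scale1r; under eq_fun do rewrite scale1r.
  by move=> y; exact: (cvg_dot (yp y) (yp y)).
pose K := closure A `&` f @^-1` [set r | r <= f a0].
have Kclosed : closed K.
  apply: closedI; first exact: closed_closure.
  by apply: preimage_closed; [move=> y _; exact: fcont|exact: closed_le].
have Kbounded : bounded_set K.
  exists (norm2 (a0 - p) + `|p|); split; first exact: num_real.
  move=> M aM y [_ fy] /=; apply/ltW/(le_lt_trans _ aM).
  rewrite -[y in `|y|](subrK p) (le_trans (ler_normD _ _))// lerD2r.
  by rewrite (le_trans (normr_le_norm2 _))// ler_sqrt ?dot_ge0.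
have [||q] := @EVT_min_rV R n f K _ (bounded_closed_compact Kbounded Kclosed).
  by exists a0; split => //=; exact: subset_closure.
  exact: continuous_subspaceT.
rewrite inE => -[Aq qa0] qmin; exists q; split=> // k Ak.
apply: (@le_of_le_affine _ _ 0 (dot (k - q) (k - q) / 2)) => t /andP[t0 t1].
have Aqt : closure A (q + t *: (k - q)).
  move=> B nB.
  have : \forall y \near q, B (y + t *: (k - y)).
    have := @cvg_homothety R 'rV[R]_n (1 - t) (t *: k) q.
    have E y : (1 - t) *: y + t *: k = y + t *: (k - y).
      by apply/rowP => i; rewrite !mxE; ring.
    by rewrite E; under eq_fun do rewrite E; exact.
  move=> /Aq[y [Ay By]]; exists (y + t *: (k - y)); split => //.
  have -> : y + t *: (k - y) = t *: k + (1 - t) *: y.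
    by apply/rowP => i; rewrite !mxE; ring.
  by apply: Aseg => //; rewrite (ltW t0).
have : f q <= f (q + t *: (k - q)).
  have [le|/ltW le] := leP (f (q + t *: (k - q))) (f a0).
    by apply: qmin; rewrite inE.
  exact: le_trans qa0 le.
rewrite /f; have -> : q + t *: (k - q) - p = - (p - q) + t *: (k - q).
  by apply/rowP => i; rewrite !mxE; ring.
rewrite -(opprB p q); move: (p - q) (k - q) => u w.
rewrite !dotE (dotC w u) add0r => h.
have : t * dot u w <= t * (t * (dot w w / 2)) by lra.
by rewrite ler_pM2l.
Qed.

Lemma affine_hull_sub (R : realType) n (A : set 'rV[R]_n) :
  A `<=` affine_hull A.
Proof.
move=> x Ax; exists 1%N, (fun=> 1), (fun=> x); split=> //.
  by rewrite big_ord1.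
by rewrite big_ord1 scale1r.
Qed.

Lemma affine_hull_comb (R : realType) n (A : set 'rV[R]_n) a b y u :
  a + b = 1 -> affine_hull A y -> A u -> affine_hull A (a *: y + b *: u).
Proof.
move=> ab1 [k [c [v [Av c1 ->]]]] Au.
exists k.+1, (fun i => oapp (fun j => a * c j) b (unlift ord0 i)),
  (fun i => oapp v u (unlift ord0 i)); split.
- by move=> i; case: unliftP => [j _|_] /=.
- rewrite big_ord_recl unlift_none/=; under eq_bigr do rewrite liftK/=.
  by rewrite -big_distrr/= c1 mulr1 addrC.
- rewrite big_ord_recl unlift_none/= addrC scaler_sumr; congr (_ + _).
  by apply: eq_bigr => i _; rewrite liftK/= scalerA.
Qed.

Lemma rint_sub (R : realType) n (A : set 'rV[R]_n) : rint A `<=` A.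
Proof. by move=> x []. Qed.

(** A point that is strictly between a relative interior point and a point of
    the set is a relative interior point. *)
Lemma rint_extend (R : realType) n (A : set 'rV[R]_n) (xs x : 'rV[R]_n) s :
  segment_closed A -> rint A xs -> 0 < s -> A (x - s *: (xs - x)) ->
  rint A x.
Proof.
move=> Aseg [Axs xsA] s0 Aw.
have s1 : 1 + s != 0 by rewrite gt_eqF// addr_gt0.
pose t := s / (1 + s).
have t01 : 0 <= t <= 1 by rewrite /t divr_ge0 ?ler_pdivrMr/=; lra.
have xE : x = t *: xs + (1 - t) *: (x - s *: (xs - x)).
  by apply/rowP => i; rewrite !mxE /t; field.
have Ax : A x by rewrite xE; exact: Aseg.
split=> //.
pose c := (1 + s) / s.
have : \forall y \near x, affine_hull A (c *: y + (xs - c *: x)) ->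
    A (c *: y + (xs - c *: x)).
  have := @cvg_homothety R 'rV[R]_n c (xs - c *: x) x.
  have -> : c *: x + (xs - c *: x) = xs by rewrite addrCA subrr addr0.
  by move=> /(_ _ xsA).
apply: filterS => y yA hy.
have yE : y = t *: (c *: y + (xs - c *: x)) + (1 - t) *: (x - s *: (xs - x)).
  by apply/rowP => i; rewrite !mxE /t /c; field; rewrite s1 gt_eqF.
rewrite yE; apply: Aseg => //; apply: yA.
have -> : c *: y + (xs - c *: x)
    = (1 + c) *: ((c / (1 + c)) *: y + (1 + c)^-1 *: xs) + (- c) *: x.
  have c1 : 1 + c != 0.
    by rewrite gt_eqF// addr_gt0// /c divr_gt0; lra.
  by apply/rowP => i; rewrite !mxE; field.
apply: affine_hull_comb => //; first by lra.
apply: affine_hull_comb => //.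
have c1 : 1 + c != 0.
  by rewrite gt_eqF// addr_gt0// /c divr_gt0; lra.
by field.
Qed.

(** Beyond [x], the line issued from the relative interior point [xs] either
    stays in the convex set [A] for a while, or is blocked by a supporting
    hyperplane at [x] that does not contain [xs]. The normal is obtained by
    projecting [- (xs - x)] on the closed cone of feasible directions at [x]. *)
Lemma extend_or_normal (R : realType) n (A : set 'rV[R]_n) (xs x : 'rV[R]_n) :
  segment_closed A -> rint A xs -> A x ->
  (exists2 s, 0 < s & A (x - s *: (xs - x))) \/
  (exists2 v, forall y, A y -> dot v (y - x) <= 0 & dot v (xs - x) < 0).
Proof.
move=> Aseg [Axs /nbhs_ballP[r/= r0 xsA]] Ax.
(* the directions along which [A] can be followed from [x] *)
pose K := [set k | exists s w, [/\ 0 < s, A w & k = s *: (w - x)]].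
have K0 : K !=set0 by exists 0, 1, x; rewrite subrr scaler0.
have Kseg : segment_closed K.
  move=> _ _ t /andP[t0 t1] [s [w [s0 Aw ->]]] [s' [w' [s'0 Aw' ->]]].
  pose u := t * s + (1 - t) * s'.
  have u0 : 0 < u.
    rewrite /u; move: t0; rewrite le_eqVlt => /predU1P[<-|t0]; first by lra.
    by rewrite ltr_wpDr ?mulr_gt0// mulr_ge0 ?subr_ge0// ltW.
  exists u, ((t * s / u) *: w + (1 - t * s / u) *: w'); split=> //.
    apply: Aseg => //; rewrite divr_ge0 ?mulr_ge0 ?(ltW s0) ?(ltW u0)//=.
    by rewrite ler_pdivrMr// mul1r /u lerDl mulr_ge0 ?(ltW s'0)// subr_ge0.
  apply/rowP => i; rewrite !mxE /u; field.
  by rewrite -/u gt_eqF.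
have [q [Kq qmin]] := closest_point (- (xs - x)) K0 Kseg.
set d := xs - x in Kq qmin *.
have [v0|v0] := eqVneq (- d - q) 0; [left|right].
  (* [- d] is approximated by a feasible direction [s *: (w - x)]; the error [v]
     is absorbed by moving [xs] to [xs + 2 *: v], which stays in [A] *)
  have [k [[s [w [s0 Aw kE]]] kq]] : K `&` ball q (r / 2) !=set0.
    by apply: Kq; apply: nbhsx_ballx; rewrite divr_gt0.
  pose v := - (k + d).
  have Axsv : A (xs + 2 *: v).
    apply: xsA.
      rewrite -ball_normE/= opprD addrA subrr sub0r normrN normrZ.
      rewrite gtr0_norm//.
      move: kq; rewrite -ball_normE/= => kq.
      have -> : v = q - k.
        rewrite /v opprD [RHS]addrC; congr (_ + _).
        by move/eqP: v0; rewrite subr_eq0 => /eqP.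
      lra.
    have -> : xs + 2 *: v = 2 *: ((- s) *: w + (1 + s) *: x) + (- 1) *: xs.
      by apply/rowP => i; rewrite /v kE /d !mxE; ring.
    apply: affine_hull_comb => //; first by lra.
    apply: affine_hull_comb => //; first by lra.
    exact: affine_hull_sub.
  exists (1 + 2 * s)^-1; first by rewrite invr_gt0; lra.
  have -> : x - (1 + 2 * s)^-1 *: d
      = (1 + 2 * s)^-1 *: (xs + 2 *: v) + (1 - (1 + 2 * s)^-1) *: w.
    by apply/rowP => i; rewrite /v kE /d !mxE; field; rewrite gt_eqF//; lra.
  apply: Aseg => //; rewrite invr_ge0 invf_le1; lra.
exists (- d - q).
  move=> y Ay; apply: (@le_of_le_affine _ _ 0 (dot (- d - q) q)) => t /andP[t0 _].
  rewrite add0r -ler_pdivrMl//.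
  have : K (t^-1 *: (y - x)) by exists t^-1, y; rewrite invr_gt0.
  by move=> /qmin; rewrite dotDr dotNr dotZr subr_le0.
have qv : dot (- d - q) q >= 0.
  have := qmin 0; rewrite sub0r dotNr oppr_le0; apply.
  by exists 1, x; rewrite subrr scaler0.
have vv : dot (- d - q) (- d - q) > 0.
  by rewrite lt_def dot_ge0 andbT; apply: contra v0 => /eqP/dot_eq0->.
have dE : d = - (- d - q) - q by rewrite opprB opprK addrAC subrr add0r.
by rewrite {2}dE dotDr !dotNr; lra.
Qed.

(** * Subgradients and Bregman divergences *)

(** Strong convexity stated with real values, at the points of the domain. *)
Definition strongly_convex_on_dom (R : realType) n (rho : R)
    (f : 'rV[R]_n -> \bar R) : Prop :=
  forall x y t, 0 <= t <= 1 -> dom f x -> dom f y ->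
    dom f (t *: x + (1 - t) *: y) /\
    fine (f (t *: x + (1 - t) *: y))
      + rho / 2 * (t * (1 - t)) * dot (x - y) (x - y)
    <= t * fine (f x) + (1 - t) * fine (f y).

Lemma dom_fineK (R : realType) n (f : 'rV[R]_n -> \bar R) x :
  proper_fun f -> dom f x -> (fine (f x))%:E = f x.
Proof. by move=> [fNy _] fx; rewrite fineK// fin_real// fNy. Qed.

Lemma strongly_convexP (R : realType) n (rho : R) (f : 'rV[R]_n -> \bar R) :
  proper_fun f -> strongly_convex rho f -> strongly_convex_on_dom rho f.
Proof.
move=> fp fc x y t t01 fx fy; have := fc x y t t01.
rewrite -(dom_fineK fp fx) -(dom_fineK fp fy) sqr_norm2.
set p := t *: x + _ => h.
have fdom : dom f p.
  rewrite /dom/= ltNge leye_eq; apply/eqP => fpy; move: h.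
  by rewrite fpy addye// leye_eq.
by split => //; move: h; rewrite -(dom_fineK fp fdom) -!EFinM -!EFinD lee_fin.
Qed.

Lemma subdiffP (R : realType) n (f : 'rV[R]_n -> \bar R) x g :
  proper_fun f ->
  subdiff f x g <-> dom f x /\
    forall y, dom f y -> fine (f x) + dot g (y - x) <= fine (f y).
Proof.
move=> fp; split=> -[fx fg]; split=> // y.
  move=> fy; have := fg y.
  by rewrite -(dom_fineK fp fx) -(dom_fineK fp fy) -EFinD lee_fin.
have [fy|] := ltP (f y) +oo%E.
  by rewrite -(dom_fineK fp fx) -(dom_fineK fp fy) -EFinD lee_fin; exact: fg.
by rewrite leye_eq => /eqP ->; rewrite leey.
Qed.

(** Strong convexity improves the subgradient inequality by a quadratic term,
    by comparing [f] at [x] and at [x + t *: (y - x)] for small [t]. *)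
Lemma subdiff_strong (R : realType) n (rho : R) (f : 'rV[R]_n -> \bar R) x y g :
  proper_fun f -> strongly_convex_on_dom rho f ->
  subdiff f x g -> dom f y ->
  fine (f x) + dot g (y - x) + rho / 2 * dot (y - x) (y - x) <= fine (f y).
Proof.
move=> fp fc /(subdiffP _ _ fp)[fx fg] fy.
apply: (@le_of_le_affine _ _ _ (rho / 2 * dot (y - x) (y - x))).
move=> t /andP[t0 t1]; have t01 : 0 <= t <= 1 by rewrite ltW.
have [fdom] := fc y x t t01 fy fx.
have := fg _ fdom.
have -> : t *: y + (1 - t) *: x - x = t *: (y - x).
  by apply/rowP => i; rewrite !mxE; ring.
rewrite dotZr => h1 h2.
rewrite -(ler_pM2l t0); lra.
Qed.

(** Strong monotonicity of the subdifferential. *)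
Lemma subdiff_monotone (R : realType) n (rho : R) (f : 'rV[R]_n -> \bar R)
    x y gx gy :
  proper_fun f -> strongly_convex_on_dom rho f ->
  subdiff f x gx -> subdiff f y gy ->
  rho * dot (y - x) (y - x) <= dot (gy - gx) (y - x).
Proof.
move=> fp fc fx fy.
have := subdiff_strong fp fc fx (proj1 fy).
have := subdiff_strong fp fc fy (proj1 fx).
rewrite -(opprB y x) (dotDl gy) !dotNr !dotNl; lra.
Qed.

Lemma near_line (R : realType) n (P : set 'rV[R]_n) (x d : 'rV[R]_n) :
  (\forall y \near x, P y) ->
  exists2 r, 0 < r & forall t, `|t| < r -> P (x + t *: d).
Proof.
move=> /nbhs_ballP[r/= r0 xrP]; have d1 : 0 < `|d| + 1 by rewrite ltr_wpDl.
exists (r / (`|d| + 1)); first exact: divr_gt0.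
move=> t; rewrite ltr_pdivlMr// => tr; apply: xrP.
rewrite -ball_normE/= opprD addrA subrr sub0r normrN normrZ.
by apply: le_lt_trans tr; rewrite ler_wpM2l// lerDl.
Qed.

(** The relative gradient at a relative interior point is a subgradient. *)
Lemma subdiff_rint (R : realType) n (f : 'rV[R]_n -> \bar R) x :
  proper_fun f -> convex_fun f -> rint_differentiable f -> rint (dom f) x ->
  subdiff f x !=set0.
Proof.
move=> fp /(strongly_convexP fp) fc fdiff xint.
have fx := rint_sub xint.
have [g gP] := fdiff x xint.
exists g; apply/(subdiffP _ _ fp); split=> // y fy.
apply: (@le_of_le_affine _ _ _ (norm2 (y - x))) => e /andP[e0 _].
have [r r0 xr] := near_line (y - x) (gP e e0).
pose t := Num.min 1 (r / 2).
have t0 : 0 < t by rewrite lt_min ltr01 divr_gt0.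
have t1 : t <= 1 by rewrite ge_min lexx.
have tr : `|t| < r.
  by rewrite gtr0_norm// gt_min; apply/orP; right; lra.
have t01 : 0 <= t <= 1 by rewrite ltW.
have [fdom] := fc y x t t01 fy fx.
have yE : t *: y + (1 - t) *: x = x + t *: (y - x).
  by apply/rowP => i; rewrite !mxE; ring.
rewrite yE in fdom * => h2; move: (xr t tr fdom).
rewrite [x + _ - x]addrC addKr dotZr norm2Z (gtr0_norm t0) ler_norml => /andP[h1 _].
rewrite -(ler_pM2l t0). lra.
Qed.

(** At a relative interior point, subgradients agree along the directions
    [y - x] that can be followed both forwards and backwards in the domain. *)
Lemma subdiff_rint_dot (R : realType) n (f : 'rV[R]_n -> \bar R) x y s g g' :
  proper_fun f -> convex_fun f -> rint_differentiable f -> rint (dom f) x ->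
  dom f y -> 0 < s -> dom f (x - s *: (y - x)) ->
  subdiff f x g -> subdiff f x g' -> dot g (y - x) = dot g' (y - x).
Proof.
move=> fp /(strongly_convexP fp) fc fdiff xint fy s0 fys.
have [g0 g0P] := fdiff x xint; have fx := rint_sub xint.
pose d := y - x.
have near t : `|t| <= Num.min 1 s -> dom f (x + t *: d).
  rewrite ler_norml => /andP[]; rewrite lerNl !le_min => /andP[_ ts] /andP[t1 _].
  have [t0|/ltW t0] := leP 0 t.
    have -> : x + t *: d = t *: y + (1 - t) *: x.
      by apply/rowP => i; rewrite !mxE; ring.
    by have [] := fc y x t _ fy fx => //; rewrite t0.
  have -> : x + t *: d = (- t / s) *: (x - s *: (y - x)) + (1 - - t / s) *: x.
    by apply/rowP => i; rewrite !mxE; field; rewrite gt_eqF.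
  have [] := fc _ x (- t / s) _ fys fx => //.
  by rewrite divr_ge0 ?oppr_ge0 ?(ltW s0)// ler_pdivrMr// mul1r.
(* it is enough to compare with the relative gradient [g0] *)
suff E h : subdiff f x h -> dot h d = dot g0 d by move=> /E -> /E ->.
move=> /(subdiffP _ _ fp)[_ hP].
have key e : 0 < e -> `|dot h d - dot g0 d| <= e * norm2 d.
  move=> e0; have [r r0 xr] := near_line d (g0P e e0).
  pose t := Num.min (Num.min 1 s) (r / 2).
  have t0 : 0 < t by rewrite !lt_min ltr01 s0 divr_gt0.
  have ts : `|t| <= Num.min 1 s by rewrite gtr0_norm// /t ge_min lexx.
  have tr : `|t| < r.
    by rewrite gtr0_norm// gt_min; apply/orP; right; lra.
  have := xr _ tr (near _ ts); have := hP _ (near _ ts).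
  have := ts; have := tr; rewrite -(normrN t) => tr' ts'.
  have := xr _ tr' (near _ ts'); have := hP _ (near _ ts').
  have xK u : x + u - x = u by rewrite addrC addKr.
  rewrite !xK !dotZr !norm2Z normrN (gtr0_norm t0).
  rewrite !ler_norml => h1 /andP[h2 h2'] h3 /andP[h4 h4'].
  by apply/andP; split; rewrite -(ler_pM2l t0); lra.
apply/eqP; rewrite -subr_eq0 -normr_le0.
by apply: (@le_of_le_affine _ _ 0 (norm2 d)) => e /andP[e0 _]; rewrite add0r key.
Qed.

(** The subdifferential is stable by addition of normals of the domain. *)
Lemma subdiff_normal (R : realType) n (f : 'rV[R]_n -> \bar R) x g v c :
  proper_fun f -> (forall y, dom f y -> dot v (y - x) <= 0) -> 0 <= c ->
  subdiff f x g -> subdiff f x (g + c *: v).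
Proof.
move=> fp vP c0 /(subdiffP _ _ fp)[fx fg]; apply/(subdiffP _ _ fp); split=> // y fy.
have := fg y fy; have := vP y fy; rewrite dotDl dotZl => h.
have : c * dot v (y - x) <= 0 by rewrite mulr_ge0_le0.
lra.
Qed.

(** If D_f(xs, x), with [xs] a relative interior point, is bounded uniformly
    over the subgradients at [x], then it does not depend on the subgradient. *)
Lemma bregman_unique (R : realType) n (f : 'rV[R]_n -> \bar R) xs x K g g' :
  proper_fun f -> convex_fun f -> rint_differentiable f -> rint (dom f) xs ->
  (forall g, subdiff f x g -> bregman f g xs x <= K) ->
  subdiff f x g -> subdiff f x g' -> bregman f g xs x = bregman f g' xs x.
Proof.
move=> fp fc fdiff xsint fK xg xg'; have fx := proj1 xg.
have seg : segment_closed (dom f).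
  by move=> a b t t01 fa fb; have [] := strongly_convexP fp fc t01 fa fb.
have [[s s0 fs]|[v vP v0]] := extend_or_normal seg xsint fx.
  have xint := rint_extend seg xsint s0 fs.
  congr (_ - _); apply: subdiff_rint_dot fs xg xg' => //.
  exact: rint_sub.
(* for this [c], the subgradient [g + c *: v] gives a divergence above [K] *)
exfalso; pose c := (`|K - bregman f g xs x| + 1) / - dot v (xs - x).
have c0 : 0 <= c by rewrite divr_ge0 ?addr_ge0// oppr_ge0 ltW.
have := fK _ (subdiff_normal fp vP c0 xg).
have cv : c * dot v (xs - x) = - (`|K - bregman f g xs x| + 1).
  by rewrite /c; field; rewrite lt_eqF.
have := ler_norm (K - bregman f g xs x).
by rewrite /bregman dotDl dotZl cv /bregman; lra.
Qed.

(** The increments of the conjugate function [z |-> max_y (dot y z - eps * f y)],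
    attained at [x], are controlled to first order: this is its differentiability,
    with gradient [x], together with the Lipschitz continuity of this gradient. *)
Lemma conjugate_gap (R : realType) n (f : 'rV[R]_n -> \bar R) (rho eps : R)
    (x y z w : 'rV[R]_n) :
  proper_fun f -> strongly_convex_on_dom rho f -> 0 < rho -> 0 < eps ->
  subdiff f x (eps^-1 *: z) -> subdiff f y (eps^-1 *: w) ->
  `|(dot w y - eps * fine (f y)) - (dot z x - eps * fine (f x)) - dot (w - z) x|
    <= (eps * rho)^-1 * dot (w - z) (w - z).
Proof.
move=> fp fc rho0 eps0 fx fy.
have c0 : 0 < eps * rho by rewrite mulr_gt0.
have := subdiff_monotone fp fc fx fy.
have [fdx /(_ _ (proj1 fy))] := (subdiffP _ _ fp).1 fx.
have [fdy /(_ _ (proj1 fx))] := (subdiffP _ _ fp).1 fy.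
rewrite -scalerBr !dotZl => h1 h2 h3.
have {}h1 : eps * fine (f y) + dot w (x - y) <= eps * fine (f x).
  have := ler_wpM2l (ltW eps0) h1.
  by rewrite mulrDr mulrA divff ?gt_eqF// mul1r.
have {}h2 : eps * fine (f x) + dot z (y - x) <= eps * fine (f y).
  have := ler_wpM2l (ltW eps0) h2.
  by rewrite mulrDr mulrA divff ?gt_eqF// mul1r.
have {}h3 : eps * rho * dot (y - x) (y - x) <= dot (w - z) (y - x).
  have := ler_wpM2l (ltW eps0) h3.
  by rewrite !mulrA divff ?gt_eqF// mul1r.
have h4 : dot (w - z) (y - x) <= (eps * rho)^-1 * dot (w - z) (w - z).
  rewrite ler_pdivlMl//.
  move: c0 h3; set c := eps * rho; move: (w - z) (y - x) => u v c0 h3.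
  have := dot_ge0 (u - c *: v); rewrite !dotE (dotC v u) => h.
  have := ler_wpM2l (ltW c0) h3; lra.
move: h1 h2 h4; rewrite !dotDr !dotDl !dotNr !dotNl => h1 h2 h4.
by rewrite ler_norml; apply/andP; split; lra.
Qed.

(** * Separable sums *)

Lemma dom_separable_sum (R : realType) N (n : 'I_N -> nat)
    (f : forall p, 'rV[R]_(n p) -> \bar R) x :
  (forall p, proper_fun (f p)) ->
  dom (separable_sum f) x <-> forall p, dom (f p) (submxrow x p).
Proof.
move=> fp; rewrite /dom/= /separable_sum; split=> [fx p|fx].
  rewrite ltNge leye_eq; apply/negP => /eqP fpy; move: fx.
  have -> : (\sum_(q < N) f q (submxrow x q) = +oo)%E; last by [].
  apply/esum_eqyP; first by move=> q _; rewrite gt_eqF// (fp q).1.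
  by exists p.
by apply: lte_sum_pinfty => p _.
Qed.

Lemma fine_separable_sum (R : realType) N (n : 'I_N -> nat)
    (f : forall p, 'rV[R]_(n p) -> \bar R) x :
  (forall p, proper_fun (f p)) -> (forall p, dom (f p) (submxrow x p)) ->
  fine (separable_sum f x) = \sum_(p < N) fine (f p (submxrow x p)).
Proof.
move=> fp fx; rewrite /separable_sum.
under eq_bigr do rewrite -(dom_fineK (fp _) (fx _)).
by rewrite sumEFin.
Qed.

Lemma separable_sum_proper (R : realType) N (n : 'I_N -> nat)
    (f : forall p, 'rV[R]_(n p) -> \bar R) x :
  (forall p, proper_fun (f p)) -> dom (separable_sum f) x ->
  proper_fun (separable_sum f).
Proof.
move=> fp fx; split; last by exists x.
move=> y; rewrite /separable_sum; elim/big_ind: _ => [|[a| |] [b| |]|p _]//=.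
  by move=> _ _; rewrite -EFinD ltNyr.
exact: (fp p).1.
Qed.

Lemma separable_sum_strongly_convex (R : realType) N (n : 'I_N -> nat) (rho : R)
    (f : forall p, 'rV[R]_(n p) -> \bar R) :
  (forall p, proper_fun (f p)) -> (forall p, strongly_convex rho (f p)) ->
  strongly_convex_on_dom rho (separable_sum f).
Proof.
move=> fp fc x y t t01 /(dom_separable_sum _ fp) fx /(dom_separable_sum _ fp) fy.
have zE p : submxrow (t *: x + (1 - t) *: y) p
    = t *: submxrow x p + (1 - t) *: submxrow y p.
  by apply/rowP => i; rewrite !mxE.
have fz p : dom (f p) (submxrow (t *: x + (1 - t) *: y) p).
  by rewrite zE; have [] := strongly_convexP (fp p) (fc p) t01 (fx p) (fy p).
split; first exact/(dom_separable_sum _ fp).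
rewrite !fine_separable_sum// dot_blocks !big_distrr -!big_split/=.
apply: ler_sum => p _; rewrite zE submxrowB.
by have [] := strongly_convexP (fp p) (fc p) t01 (fx p) (fy p).
Qed.

(** First-order optimality in the definition of the mirror map. *)
Lemma mirror_map_subdiff (R : realType) N (n : 'I_N -> nat) (G : game R n)
    (theta : forall p, 'rV[R]_(n p) -> \bar R) eps z x :
  0 < eps -> (forall p, proper_fun (theta p)) ->
  (forall p, dom (theta p) = strat G p) ->
  mirror_map G theta eps z x -> subdiff (separable_sum theta) x (eps^-1 *: z).
Proof.
move=> eps0 fp fdom zx.
have fx p : dom (theta p) (submxrow x p) by rewrite fdom; have [] := zx p.
have hx : dom (separable_sum theta) x by apply/(dom_separable_sum _ fp).
apply/(subdiffP _ _ (separable_sum_proper fp hx)); split=> // y.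
move=> /(dom_separable_sum _ fp) fy.
have zxy p : eps * fine (theta p (submxrow x p))
       + dot (submxrow z p) (submxrow (y - x) p)
    <= eps * fine (theta p (submxrow y p)).
  have [_] := zx p; move=> /(_ (submxrow y p)); rewrite -fdom => /(_ (fy p)).
  rewrite -(dom_fineK (fp p) (fy p)) -(dom_fineK (fp p) (fx p)).
  rewrite -!EFinM -!EFinB lee_fin submxrowB dotDr dotNr.
  rewrite !(dotC (submxrow z p)); lra.
rewrite !fine_separable_sum// -(ler_pM2l eps0) mulrDr dotZl mulrA.
rewrite divff ?gt_eqF// mul1r dot_blocks !big_distrr -big_split/=.
by apply: ler_sum => p _.
Qed.

(** * Calculus along a trajectory *)

Lemma is_derive1P (R : realType) (V : normedModType R) (f : R -> V) t df :
  is_derive (t : R^o) 1 f df <->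
  h^-1 *: (f (h + t) - f t) @[h --> (0 : R)^'] --> df.
Proof.
have E : (fun h : R => h^-1 *: ((f \o shift t) (h *: (1 : R^o)) - f t))
    = (fun h => h^-1 *: (f (h + t) - f t)).
  by apply/funext => h /=; rewrite /GRing.scale/= mulr1.
split=> [[fd <-]|fd].
  by move: fd; rewrite /derivable /derive E => fd; exact: fd.
split; first by rewrite /derivable E; exact: cvgP fd.
by rewrite /derive E; exact/cvg_lim.
Qed.

Lemma is_derive_coord (R : realType) n (u : R -> 'rV[R]_n) t du i :
  is_derive (t : R^o) 1 u du ->
  is_derive (t : R^o) 1 (fun s => u s 0 i : R^o) (du 0 i).
Proof.
move=> /is_derive1P ud; apply/is_derive1P.
have := cvg_comp _ (fun y : 'rV_n => y 0 i) ud (@coord_continuous R 1 n 0 i du).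
suff -> : (fun y : 'rV[R]_n => y 0 i) \o (fun h => h^-1 *: (u (h + t) - u t))
    = fun h => h^-1 *: ((u (h + t) 0 i : R^o) - u t 0 i) by [].
by apply/funext => h; rewrite /= !mxE.
Qed.

Lemma is_derive_dot (R : realType) n (u v : R -> 'rV[R]_n) t du dv :
  is_derive (t : R^o) 1 u du -> is_derive (t : R^o) 1 v dv ->
  is_derive (t : R^o) 1 (fun s => dot (u s) (v s) : R^o)
    (dot du (v t) + dot (u t) dv).
Proof.
move=> ud vd.
have -> : (fun s => dot (u s) (v s) : R^o)
    = \sum_(i < n) ((fun s => u s 0 i : R^o) * (fun s => v s 0 i : R^o)).
  by apply/funext => s; rewrite fct_sumE.
apply: is_derive_eq.
  apply: is_derive_sum => i; apply: is_deriveM; exact: is_derive_coord.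
rewrite -big_split; apply: eq_bigr => i _ /=.
by rewrite addrC; congr (_ + _); exact: mulrC.
Qed.

(** A function whose increments are linear in those of [u], up to a quadratic
    error, inherits convergence from [u]. *)
Lemma cvg_quadratic_gap (R : realType) n (T : Type) (F : set_system T)
    {FF : Filter F} (u : T -> 'rV[R]_n) (phi : T -> R) (a w : 'rV[R]_n) (b C : R) :
  u @ F --> a ->
  (\forall s \near F,
     `|phi s - b - dot (u s - a) w| <= C * dot (u s - a) (u s - a)) ->
  phi @ F --> b.
Proof.
move=> ua phib.
have ua0 : u s - a @[s --> F] --> (0 : 'rV[R]_n).
  rewrite -(subrr a).
  exact: (@cvgB R 'rV[R]_n T F FF u (fun=> a) a a ua (@cvg_cst _ a _ F FF)).
have d1 : dot (u s - a) w @[s --> F] --> dot (0 : 'rV[R]_n) w.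
  exact: (cvg_dot ua0 (@cvg_cst _ w _ F FF)).
have d2 : dot (u s - a) (u s - a) @[s --> F] --> dot (0 : 'rV[R]_n) 0.
  exact: (cvg_dot ua0 ua0).
have z0 v : dot (0 : 'rV[R]_n) v = 0 by rewrite -(scale0r v) dotZl mul0r.
rewrite !z0 in d1 d2.
have d3 : C * dot (u s - a) (u s - a) @[s --> F] --> 0.
  by rewrite -(mulr0 C); exact: (cvgM (@cvg_cst R C _ F FF) d2).
apply: (@squeeze_cvgr T F FF R
  (fun s => b + dot (u s - a) w - C * dot (u s - a) (u s - a))
  (fun s => b + dot (u s - a) w + C * dot (u s - a) (u s - a))).
- apply: filterS phib => s; rewrite ler_norml => /andP[h1 h2].
  by apply/andP; split; lra.
- have := cvgB (cvgD (@cvg_cst R b _ F FF) d1) d3.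
  by rewrite addr0 subr0; exact.
- have := cvgD (cvgD (@cvg_cst R b _ F FF) d1) d3.
  by rewrite !addr0; exact.
Qed.

(** Chain rule for a function [phi] that is differentiable as a function of
    [u t], with gradient [w] and a quadratic error. *)
Lemma is_derive_quadratic_gap (R : realType) n (u : R -> 'rV[R]_n)
    (phi : R -> R^o) (t : R) (du w : 'rV[R]_n) (C : R) :
  is_derive (t : R^o) 1 u du ->
  (\forall s \near t,
     `|phi s - phi t - dot (u s - u t) w|
       <= C * dot (u s - u t) (u s - u t)) ->
  is_derive (t : R^o) 1 phi (dot du w).
Proof.
move=> /is_derive1P ud phit; apply/is_derive1P.
pose q h := h^-1 *: (u (h + t) - u t).
have d0 : \forall h \near (0 : R)^', h != 0 by exact: nbhs_dnbhs_neq.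
have phit' : \forall h \near (0 : R)^',
    `|phi (h + t) - phi t - dot (u (h + t) - u t) w|
       <= C * dot (u (h + t) - u t) (u (h + t) - u t).
  move: phit => /nbhs_ballP[r/= r0 tr]; exists r => // h.
  rewrite /ball_/= sub0r normrN => hr _; apply: tr.
  by rewrite -ball_normE/= opprD addrCA subrr addr0 normrN.
have qw : dot (q h) w @[h --> (0 : R)^'] --> dot du w.
  exact: (cvg_dot ud (cvg_cst w)).
have qq : dot (q h) (q h) @[h --> (0 : R)^'] --> dot du du.
  exact: (cvg_dot ud ud).
have h0 : `|h| @[h --> (0 : R)^'] --> `|0 : R|.
  by apply: cvg_norm; exact: cvg_within.
have d3 : `|h| * (C * dot (q h) (q h)) @[h --> (0 : R)^'] --> 0.
  have := cvgM h0 (cvgM (@cvg_cst R C _ _ _) qq).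
  by rewrite normr0 mul0r; exact.
apply: (@squeeze_cvgr R (0 : R)^' _ R
  (fun h => dot (q h) w - `|h| * (C * dot (q h) (q h)))
  (fun h => dot (q h) w + `|h| * (C * dot (q h) (q h)))).
- near=> h.
  have hn : h != 0 by near: h.
  have uE : u (h + t) - u t = h *: q h by rewrite scalerA divff// scale1r.
  have : `|phi (h + t) - phi t - dot (u (h + t) - u t) w|
       <= C * dot (u (h + t) - u t) (u (h + t) - u t) by near: h.
  rewrite uE; move: (q h) => k; rewrite !dotE => e.
  have : `|h^-1 * (phi (h + t) - phi t) - dot k w| <= `|h| * (C * dot k k).
    have hp : 0 < `|h| by rewrite normr_gt0.
    rewrite -(ler_pM2l hp) -normrM mulrBr.
    rewrite mulrA divff// mul1r (le_trans e)// (mulrA `|h|) -normrM -expr2.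
    by rewrite ger0_norm ?sqr_ge0//; lra.
  rewrite ler_norml => /andP[e1 e2].
  by apply/andP; split; rewrite /GRing.scale/=; lra.
- by have := cvgB qw d3; rewrite subr0; exact.
- by have := cvgD qw d3; rewrite addr0; exact.
Unshelve. all: by end_near.
Qed.

Lemma derive_le0_le (R : realType) (f df : R -> R) :
  (forall t : R, 0 < t -> is_derive (t : R^o) 1 f (df t)) ->
  (forall t : R, 0 < t -> df t <= 0) ->
  f t @[t --> 0^'+] --> f 0 -> forall t, 0 <= t -> f t <= f 0.
Proof.
move=> fd df0 f0 t t0.
apply: (@ler0_derive1_nincry R f 0) => //.
- by move=> s; rewrite in_itv/= andbT => /fd[].
- move=> s; rewrite in_itv/= andbT => s0; rewrite derive1E.
  by have [_ ->] := fd s s0; exact: df0.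
- apply/continuous_within_itvcyP; split=> // s; rewrite in_itv/= andbT => /fd[+ _].
  by move=> /derivable1_diffP/differentiable_continuous.
Qed.

Lemma is_derive_expR_linear (R : realType) (k t : R) :
  is_derive (t : R^o) 1 (fun s => expR (k * s) : R^o) (k * expR (k * t)).
Proof.
have lin : is_derive (t : R^o) 1 (fun s => k * s : R^o) k.
  have := is_deriveZ k (is_derive_id (t : R^o) 1).
  by rewrite /GRing.scale/= mulr1; exact.
have := @is_derive1_comp R expR (fun s => k * s) t _ _
  (is_derive_expR (k * t)) lin.
by rewrite mulrC; exact.
Qed.

Lemma cvg_exp_decay (R : realType) n (u : R -> 'rV[R]_n) (a : 'rV[R]_n) (k C : R) :
  0 < k ->
  (forall t, 0 <= t -> norm2 (a - u t) ^+ 2 <= C * expR (- (k * t))) ->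
  u t @[t --> +oo] --> a.
Proof.
move=> k0 ua.
have decay : C * expR (- (k * t)) @[t --> +oo] --> (0 : R).
  have kt : k * t @[t --> +oo] --> +oo.
    by apply: gt0_cvgMry => //; exact: cvg_id.
  have := cvgM (@cvg_cst R C _ (+oo : set_system R) _)
    (cvg_comp _ (fun t => expR (- t)) kt (@cvgr_expR R)).
  by rewrite mulr0; exact.
apply/(@cvgrPdist_lt R 'rV[R]_n) => e e0.
have e20 : 0 < e ^+ 2 by rewrite exprn_gt0.
near=> t.
have t0 : 0 <= t by near: t; exact: nbhs_pinfty_ge.
have : C * expR (- (k * t)) < e ^+ 2.
  near: t; have := cvgr_lt (0 : R) decay (e ^+ 2) e20; exact.
move=> /(le_lt_trans (ua t t0)).
rewrite ltr_pXn2r ?nnegrE ?sqrtr_ge0 ?(ltW e0)//.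
exact/le_lt_trans/normr_le_norm2.
Unshelve. all: by end_near.
Qed.

(** * Exponential decay of the energy *)

Theorem theorem2 (R : realType) (N : nat) (n : 'I_N -> nat) (G : game R n)
    (theta : forall p : 'I_N, 'rV[R]_(n p) -> \bar R)
    (rho eta alpha beta eps : R)
    (xs : 'rV[R]_(\sum_(p < N) n p))
    (z xi x : R -> 'rV[R]_(\sum_(p < N) n p)) (gamma : R -> R^o)
    (hG : concave_game G)
    (hrho : 0 < rho) (heta : 0 < eta) (halpha : 0 < alpha) (hbeta : 0 < beta)
    (heps : 0 < eps)
    (htheta : forall p : 'I_N,
       [/\ closed_fun (theta p), proper_fun (theta p),
           strongly_convex rho (theta p) & dom (theta p) = strat G p])
    (hint : rint (joint_strat G) xs)
    (hVS : variationally_stable G xs)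
    (huniq : forall y, rint (joint_strat G) y -> variationally_stable G y ->
       y = xs)
    (hsVS : rel_strongly_VS G (separable_sum theta) eta xs)
    (hgamma0 : 0 < gamma 0)
    (hdyn : MD2gamma G theta alpha beta eps eta z xi x gamma) :
  [/\ x t @[t --> +oo] --> xs,
      forall t : R, 0 <= t -> subdiff (separable_sum theta) (x t) !=set0,
      forall g0, subdiff (separable_sum theta) (x 0) g0 ->
      forall (t : R) g, 0 <= t -> subdiff (separable_sum theta) (x t) g ->
        bregman (separable_sum theta) g xs (x t)
          <= expR (- (eta * eps^-1 * t)) *
             (alpha * gamma 0 / (2 * beta * eps) * norm2 (xi 0 - xs) ^+ 2
              + bregman (separable_sum theta) g0 xs (x 0))
    & forall g0, subdiff (separable_sum theta) (x 0) g0 ->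
      forall t : R, 0 <= t ->
        norm2 (xs - x t) ^+ 2
          <= 2 * rho^-1 * expR (- (eta * eps^-1 * t)) *
             (alpha * gamma 0 / (2 * beta * eps) * norm2 (xi 0 - xs) ^+ 2
              + bregman (separable_sum theta) g0 xs (x 0))].

Proof.
have [hconv hdom hdiff hnash hineq] := hsVS.
have [[zcont xicont gammacont] dz dxi dgamma hmirror] := hdyn.
set h := separable_sum theta in hconv hdom hdiff hineq *.
have tp p : proper_fun (theta p) by have [] := htheta p.
have tdom p : dom (theta p) = strat G p by have [] := htheta p.
have hsc : strongly_convex_on_dom rho h.
  by apply: separable_sum_strongly_convex => // p; have [] := htheta p.
have xsint : rint (dom h) xs by rewrite hdom.
have hxs := rint_sub xsint.
have hp : proper_fun h := separable_sum_proper tp hxs.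
have xsub t : 0 <= t -> subdiff h (x t) (eps^-1 *: z t).
  by move=> t0; apply: mirror_map_subdiff heps tp tdom (hmirror t t0).
have [gs hgs] := subdiff_rint hp hconv hdiff xsint.
(* the divergence from [x t] to [xs] is nonnegative and can be dropped *)
have VS t g : subdiff h (x t) g ->
    dot (pseudo_gradient G (x t)) (x t - xs) <= - eta * bregman h g xs (x t).
  move=> hg; have hxt : dom h (x t) := proj1 hg.
  have jx : joint_strat G (x t) by rewrite -hdom.
  apply: (le_trans (hineq _ _ _ jx hgs hg)).
  have := ((subdiffP _ _ hp).1 hgs).2 _ hxt => hgsx.
  rewrite mulrDr gerDr mulNr oppr_le0 mulr_ge0 ?(ltW heta)//.
  by rewrite /bregman; lra.
(* the inequality [VS] is the uniform bound over the subgradients *)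
have Dunique t g g' : subdiff h (x t) g -> subdiff h (x t) g' ->
    bregman h g xs (x t) = bregman h g' xs (x t).
  apply: (@bregman_unique _ _ h xs (x t)
    (- eta^-1 * dot (pseudo_gradient G (x t)) (x t - xs))) => // g1 /VS hg1.
  by rewrite mulNr lerNr ler_pdivrMl// mulrN -mulNr.
pose k := eta * eps^-1.
have k0 : 0 < k by rewrite divr_gt0.
pose D t := bregman h (eps^-1 *: z t) xs (x t).
pose Q t := dot (xi t - xs) (xi t - xs).
pose A := alpha / (2 * beta).
have A0 : 0 < A by rewrite divr_gt0// mulr_gt0.
pose Phi t : R := dot (z t) (x t) - eps * fine (h (x t)).
(* [E] is [eps * D], written with the conjugate [Phi] of [eps * h] along [z] *)
pose E t : R := eps * fine (h xs) + Phi t - dot (z t) xs.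
have ED t : E t = eps * D t.
  rewrite /D /bregman dotZl dotDr dotNr !mulrBr !mulrA divff ?gt_eqF// !mul1r.
  by rewrite /E /Phi; lra.
have Phigap t s : 0 <= t -> 0 <= s ->
    `|Phi s - Phi t - dot (z s - z t) (x t)|
      <= (eps * rho)^-1 * dot (z s - z t) (z s - z t).
  by move=> t0 s0; apply: conjugate_gap => //; exact: xsub.
have dE t : 0 < t -> is_derive (t : R^o) 1 (E : R -> R^o)
    (dot (pseudo_gradient G (x t) - (gamma t * alpha) *: (x t - xi t)) (x t - xs)).
  move=> t0; set dzt := _ - _.
  have dPhi : is_derive (t : R^o) 1 (Phi : R -> R^o) (dot dzt (x t)).
    apply: (is_derive_quadratic_gap (dz t t0)).
    near=> s; apply: Phigap; first exact: ltW.
    by apply: ltW; near: s; exact: lt_nbhsr.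
  have dzxs := is_derive_dot (dz t t0) (is_derive_cst xs (t : R^o) 1).
  have := is_deriveB (is_deriveD
    (is_derive_cst (eps * fine (h xs) : R^o) (t : R^o) 1) dPhi) dzxs.
  have d0 : dot (z t) 0 = 0 by rewrite -(scale0r 0) dotZr mul0r.
  by rewrite d0 addr0 add0r dotDr dotNr; exact.
have dexp t := is_derive_expR_linear k t.
have exp0 : expR (k * t) @[t --> (0 : R)^'+] --> expR (k * 0).
  apply: cvg_at_right_filter; have [/derivable1_diffP + _] := dexp 0.
  by move=> /differentiable_continuous.
have right0 (V : normedModType R) (f : R -> V) :
    {within `[0, +oo[, continuous f} -> f t @[t --> 0^'+] --> f 0.
  by move=> /continuous_within_itvcyP[].
(* [expR (k * t) * gamma t] is constant *)
have gamma_ge0 t : 0 <= t -> 0 <= gamma t.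
  move=> t0.
  have := @derive_le0_le R (fun t => - (expR (k * t) * gamma t)) (fun=> 0).
  move=> /(_ _ _ _ t t0); rewrite mulr0 expR0 mul1r lerN2 => H.
  have : gamma 0 <= expR (k * t) * gamma t.
    apply: H => //.
      move=> s s0; apply: is_derive_eq.
        exact: (is_deriveN (is_deriveM (dexp s) (dgamma s s0))).
      by rewrite /GRing.scale/= /k; ring.
    have := cvgN (cvgM exp0 (right0 _ _ gammacont)).
    by rewrite mulr0 expR0 mul1r; exact.
  move=> /(lt_le_trans hgamma0); rewrite pmulr_rgt0 ?expR_gt0//.
  exact: ltW.
(* the rescaled energy; [dV] below is the derivative of the energy itself *)
pose F t : R := expR (k * t) * (gamma t * A * Q t + E t).
have Fle t : 0 <= t -> F t <= F 0.
  pose dV t : R := - eta * eps^-1 * gamma t * A * Q t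
    + gamma t * A * (2 * dot (beta *: (x t - xi t)) (xi t - xs))
    + dot (pseudo_gradient G (x t) - (gamma t * alpha) *: (x t - xi t))
        (x t - xs).
  apply: (@derive_le0_le R F
    (fun t => expR (k * t) * (k * (gamma t * A * Q t + E t) + dV t)))
    => [{}t t0|{}t t0|].
  - have dQ : is_derive (t : R^o) 1 (Q : R -> R^o)
        (2 * dot (beta *: (x t - xi t)) (xi t - xs)).
      have dxixs : is_derive (t : R^o) 1 (fun s => xi s - xs) (beta *: (x t - xi t)).
        have := is_deriveB (dxi t t0) (is_derive_cst xs (t : R^o) 1).
        by rewrite subr0; exact.
      have := is_derive_dot dxixs dxixs.
      by rewrite (dotC (xi t - xs)) -mulr2n mulr_natl; exact.
    apply: is_derive_eq.
      apply: (is_deriveM (dexp t) (is_deriveD (is_deriveM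
        (is_deriveM (dgamma t t0) (is_derive_cst (A : R^o) _ _)) dQ) (dE t t0))).
    rewrite /dV; set a := dot (beta *: _) _; set b := dot (_ - _ *: _) _.
    transitivity (expR (k * t) * (gamma t * A * (2 * a)
        + Q t * (gamma t * 0 + A * (- eta * eps^-1 * gamma t)) + b)
      + (gamma t * A * Q t + E t) * (k * expR (k * t))); first by [].
    by ring.
  - rewrite pmulr_rle0 ?expR_gt0//.
    have := VS t _ (xsub t (ltW t0)); rewrite -/(D t) => VSt.
    have kE : k * E t = eta * D t by rewrite ED /k; field; rewrite gt_eqF.
    have Ab : A * (2 * beta) = alpha by rewrite /A divfK// gt_eqF// mulr_gt0.
    have ww : 0 <= gamma t * alpha * dot (x t - xi t) (x t - xi t).
      by rewrite !mulr_ge0 ?dot_ge0 ?gamma_ge0 ?(ltW halpha)// ltW.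
    (* this splitting turns the terms in [gamma] into the square in [ww] *)
    have xE : x t - xs = (x t - xi t) + (xi t - xs) by rewrite addrA subrK.
    rewrite mulrDr kE /dV dotZl (dotDl (pseudo_gradient _ _)) dotNl dotZl -Ab.
    have -> : dot (x t - xi t) (x t - xs)
        = dot (x t - xi t) (x t - xi t) + dot (x t - xi t) (xi t - xs).
      by rewrite xE dotDr.
    move: ww; rewrite -Ab /k; lra.
  - have z0 := right0 _ _ zcont; have xi0 := right0 _ _ xicont.
    have Phi0 : Phi t @[t --> 0^'+] --> Phi 0.
      apply: (cvg_quadratic_gap z0).
      by apply: filterS (nbhs_right_ge 0) => s s0; exact: Phigap.
    have E0 : E t @[t --> 0^'+] --> E 0.
      exact: (cvgB (cvgD (cvg_cst _) Phi0) (cvg_dot z0 (cvg_cst xs))).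
    have Q0 : Q t @[t --> 0^'+] --> Q 0.
      have xixs0 : xi t - xs @[t --> 0^'+] --> xi 0 - xs.
        exact: (@cvgB R 'rV[R]_(\sum_(p < N) n p) _ _ _ _ (fun=> xs) _ _ xi0
                  (cvg_cst xs)).
      exact: (cvg_dot xixs0 xixs0).
    exact: (cvgM exp0 (cvgD (cvgM (cvgM (right0 _ _ gammacont) (cvg_cst A)) Q0) E0)).
have Dle t : 0 <= t -> D t <= expR (- (k * t)) *
    (alpha * gamma 0 / (2 * beta * eps) * norm2 (xi 0 - xs) ^+ 2 + D 0).
  move=> t0; have := Fle t t0.
  rewrite /F !ED mulr0 expR0 mul1r => H.
  have Qt : 0 <= gamma t * A * Q t.
    by apply: mulr_ge0 (dot_ge0 _); rewrite mulr_ge0 ?gamma_ge0 ?(ltW A0).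
  rewrite expRN ler_pdivlMl ?expR_gt0// -(ler_pM2l heps) sqr_norm2.
  apply: (@le_trans _ _ (expR (k * t) * (gamma t * A * Q t + eps * D t))).
    by rewrite mulrCA ler_pM2l ?expR_gt0// lerDr.
  apply: (le_trans H); rewrite le_eqVlt; apply/orP; left; apply/eqP.
  by rewrite /A /Q; field; rewrite !gt_eqF.
have Dle' t g0 : 0 <= t -> subdiff h (x 0) g0 -> D t <= expR (- (k * t)) *
    (alpha * gamma 0 / (2 * beta * eps) * norm2 (xi 0 - xs) ^+ 2
      + bregman h g0 xs (x 0)).
  by move=> t0 hg0; rewrite (Dunique _ _ _ hg0 (xsub 0 (lexx 0))); exact: Dle.
have normle g0 t : subdiff h (x 0) g0 -> 0 <= t ->
    norm2 (xs - x t) ^+ 2 <= 2 * rho^-1 * expR (- (k * t)) *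
      (alpha * gamma 0 / (2 * beta * eps) * norm2 (xi 0 - xs) ^+ 2
       + bregman h g0 xs (x 0)).
  move=> hg0 t0; have := Dle' t g0 t0 hg0.
  have := subdiff_strong hp hsc (xsub t t0) hxs.
  rewrite -sqr_norm2 => H1 H2; rewrite -mulrA.
  have {}H1 : rho / 2 * norm2 (xs - x t) ^+ 2 <= D t.
    by rewrite /D /bregman; lra.
  have rho2 : 0 < rho / 2 by rewrite divr_gt0.
  rewrite -(ler_pM2l rho2) (mulrA _ (2 * rho^-1)).
  rewrite (_ : rho / 2 * (2 * rho^-1) = 1) ?mul1r.
    exact: le_trans H1 H2.
  by field; rewrite gt_eqF.
split.
- apply: (cvg_exp_decay k0 (C := 2 * rho^-1 *
      (alpha * gamma 0 / (2 * beta * eps) * norm2 (xi 0 - xs) ^+ 2 + D 0))) => t t0.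
  by rewrite mulrAC; exact: normle _ t (xsub 0 (lexx 0)) t0.
- by move=> t t0; exists (eps^-1 *: z t); exact: xsub.
- by move=> g0 hg0 t g t0 hg; rewrite (Dunique t g _ hg (xsub t t0)); exact: Dle'.
- by move=> g0 hg0 t t0; exact: normle.
Unshelve. all: by end_near.
Qed.
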